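(* Let $R$ be a commutative (not necessarily Noetherian) ring, $\mathfrak{T}$ a half centered torsion theory of $R$-modules, $\mathfrak{a}$ a finitely generated ideal of $R$ and $M$ a weakly Laskerian $R$-module. Then $$\mathfrak{T}\text{-}\mathrm{c.grade}_R(\mathfrak{a},M)=\mathfrak{T}\text{-}\mathrm{K.grade}_R(\mathfrak{a},M).$$
   Context: A torsion theory of $R$-modules is a class $\mathfrak{T}$ of $R$-modules closed under taking submodules, quotients, extensions and directed (direct) limits (in particular it contains $0$ and is closed under isomorphism). A prime ideal $\mathfrak{p}$ of $R$ is weakly associated to an $R$-module $M$ if $\mathfrak{p}$ is minimal over $(0:_R m)$ for some $m\in M$; $\mathrm{wAss}_R(M)$ is the set of all such primes. A torsion theory $\mathfrak{T}$ is half centered if, for every $R$-module $M$, one has $M\in\mathfrak{T}$ whenever $R/\mathfrak{p}\in\mathfrak{T}$ for all $\mathfrak{p}\in\mathrm{wAss}_R(M)$. An $R$-module $M$ is weakly Laskerian if each quotient of $M$ has only finitely many weakly associated prime ideals. For a finite sequence $\underline{x}$ in $R$, $\mathbb{K}_\bullet(\underline{x})$ is the Koszul complex of $R$ with respect to $\underline{x}$, and $H^i(\underline{x},M)$ is the $i$-th cohomology of $\mathrm{Hom}_R(\mathbb{K}_\bullet(\underline{x}),M)$. For $\mathfrak{a}$ with finite generating set $\underline{x}$, $\mathfrak{T}\text{-}\mathrm{K.grade}_R(\mathfrak{a},M)=\inf\{i\in\mathbb{N}_0: H^i(\underline{x},M)\notin\mathfrak{T}\}$ (with $\inf\emptyset=+\infty$);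 this does not depend on the choice of the finite generating set. A sequence $x_1,\ldots,x_r$ in $R$ is a weak $M$-regular sequence with respect to $\mathfrak{T}$ if $((x_1,\ldots,x_{i-1})M:_M x_i)/(x_1,\ldots,x_{i-1})M\in\mathfrak{T}$ for all $i=1,\ldots,r$. $\mathfrak{T}\text{-}\mathrm{c.grade}_R(\mathfrak{a},M)$ is the supremum of the lengths of all weak $M$-regular sequences with respect to $\mathfrak{T}$ contained in $\mathfrak{a}$. *)

(* Defs.v *)
From HB Require Import structures.
From mathcomp Require Import all_boot all_order all_algebra.
From mathcomp Require Import ring_quotient generic_quotient.
From mathcomp Require Import boolp classical_sets functions cardinality.
From mathcomp Require Import constructive_ereal.

Set Implicit Arguments.
Unset Strict Implicit.
Unset Printing Implicit Defensive.

Import GRing.Theory.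
Import Quotient.Exports.

Local Open Scope ring_scope.
Local Open Scope quotient_scope.

(* Submodules of V are the elements of MathComp's [submodClosed V]; their
   membership predicates are boolean, but [submod] below turns any
   Prop-valued submodule predicate into one.  Ideals of R are the
   submodules of the regular module [R^o]. *)

Section Submodule.
Variables (R : pzRingType) (V : lmodType R).

Definition submodule_pred (P : V -> Prop) : Prop :=
  [/\ P 0, forall u v, P u -> P v -> P (u + v) & forall a v, P v -> P (a *: v)].

Definition submod_mem (P : V -> Prop) (hP : submodule_pred P) : V -> bool :=
  fun v => `[< P v >].

Lemma submod_mem_closed P (hP : submodule_pred P) :
  subsemimod_closed (submod_mem hP).
Proof.
case: (hP) => h0 hD hZ; split; [split|] => [|u v|a u].
- exact/asboolP.
- by move=> /asboolP hu /asboolP hv; apply/asboolP/hD.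
- by move=> /asboolP hu; apply/asboolP/hZ.
Qed.
HB.instance Definition _ P (hP : submodule_pred P) :=
  GRing.isSubmodClosed.Build R V (submod_mem hP) (submod_mem_closed hP).

Definition submod P (hP : submodule_pred P) : submodClosed V :=
  GRing.SubmodClosed.clone R V (submod_mem hP) _.

Lemma submodP P (hP : submodule_pred P) v : reflect (P v) (v \in submod hP).
Proof. exact: asboolP. Qed.

Lemma submod_eq (A B : submodClosed V) : A =i B -> A = B.
Proof.
case: A B => [A cA] [B cB] AB.
have E : A = B by apply/funext => v; exact: AB.
case: _ / E cB {AB} => cB; congr GRing.SubmodClosed.Pack.
case: cA cB => [[a1] [a2]] [[b1] [b2]].
by rewrite (Prop_irrelevance a1 b1) (Prop_irrelevance a2 b2).
Qed.

End Submodule.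

Section SubQuotient.
Variables (R : pzRingType) (V : lmodType R).
Implicit Type N : submodClosed V.

Record sub_mod N := SubMod { sub_val : V; sub_valP : sub_val \in N }.
HB.instance Definition _ N := [isSub for @sub_val N].
HB.instance Definition _ N := [Choice of sub_mod N by <:].
HB.instance Definition _ N := [SubChoice_isSubLmodule of sub_mod N by <:].

Lemma sub_val_linear N : linear (@sub_val N).
Proof. by []. Qed.
HB.instance Definition _ N :=
  GRing.isLinear.Build R (sub_mod N) V *:%R (@sub_val N) (@sub_val_linear N).

Lemma sub_val_inj N : injective (@sub_val N).
Proof. exact: val_inj. Qed.

(* [submodClosed] does not inherit from [zmodClosed], which [Quotient.quot]
   needs. *)
Definition carrier N : V -> bool := fun v => v \in N.

Lemma carrier_zmod_closed N : zmod_closed (carrier N).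
Proof.
split=> [|u v Nu Nv]; rewrite unfold_in /carrier ?rpred0 //.
by rewrite -[- v]scaleN1r rpredD // rpredZ.
Qed.
HB.instance Definition _ N :=
  GRing.isZmodClosed.Build V (carrier N) (carrier_zmod_closed N).

Definition zcarrier N : zmodClosed V := GRing.ZmodClosed.clone V (carrier N) _.

Definition quot_mod N : Type := Quotient.quot (zcarrier N).
HB.instance Definition _ N := GRing.Zmodule.on (quot_mod N).

Definition quot_proj N (v : V) : quot_mod N := \pi_(Quotient.quot (zcarrier N)) v.

Definition quot_scale N (a : R) (q : quot_mod N) : quot_mod N :=
  quot_proj N (a *: repr (q : Quotient.quot (zcarrier N))).

Lemma quot_projP N u v : reflect (quot_proj N u = quot_proj N v) (u - v \in N).
Proof.
apply: (iffP idP) => [Nuv|/eqP]; first apply/eqP.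
  by rewrite /quot_proj -Quotient.idealrBE.
by rewrite /quot_proj -Quotient.idealrBE.
Qed.

Lemma quot_projD N u v : quot_proj N (u + v) = quot_proj N u + quot_proj N v.
Proof. by rewrite /quot_proj raddfD. Qed.

Lemma quot_reprK N (q : quot_mod N) :
  quot_proj N (repr (q : Quotient.quot (zcarrier N))) = q.
Proof. exact: reprK. Qed.

Lemma quot_projZ N a v : quot_scale a (quot_proj N v) = quot_proj N (a *: v).
Proof.
apply/quot_projP; rewrite -scalerBr rpredZ //.
by apply/quot_projP; rewrite quot_reprK.
Qed.

Let quotA N a b (q : quot_mod N) :
  quot_scale a (quot_scale b q) = quot_scale (a * b) q.
Proof. by rewrite -(quot_reprK q) !quot_projZ scalerA. Qed.

Let quot1 N : left_id 1 (@quot_scale N).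
Proof. by move=> q; rewrite -(quot_reprK q) quot_projZ scale1r. Qed.

Let quotDr N : right_distributive (@quot_scale N) +%R.
Proof.
move=> a p q; rewrite -(quot_reprK p) -(quot_reprK q) -quot_projD !quot_projZ.
by rewrite scalerDr quot_projD.
Qed.

Let quotDl N q : {morph (@quot_scale N)^~ q : a b / a + b}.
Proof.
by move=> a b; rewrite -(quot_reprK q) !quot_projZ scalerDl quot_projD.
Qed.

HB.instance Definition _ N := GRing.Zmodule_isLmodule.Build R (quot_mod N)
  (@quotA N) (@quot1 N) (@quotDr N) (@quotDl N).

Lemma quot_proj_linear N : linear (quot_proj N).
Proof. by move=> a u v; rewrite quot_projD -quot_projZ. Qed.
HB.instance Definition _ N :=
  GRing.isLinear.Build R V (quot_mod N) *:%R (quot_proj N) (quot_proj_linear N).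

End SubQuotient.

Section KernelImage.
Variables (R : pzRingType) (U V : lmodType R) (f : {linear U -> V}).

Lemma ker_subproof : submodule_pred (fun u => f u = 0).
Proof.
split=> [|u v|a u]; rewrite ?linear0 //.
  by rewrite linearD => -> ->; rewrite addr0.
by rewrite linearZ => /= ->; rewrite scaler0.
Qed.
Definition ker : submodClosed U := submod ker_subproof.

Lemma im_subproof : submodule_pred (fun v => exists u, f u = v).
Proof.
split=> [|u v|a u].
- by exists 0; rewrite linear0.
- by move=> [x <-] [y <-]; exists (x + y); rewrite linearD.
- by move=> [x <-]; exists (a *: x); rewrite linearZ.
Qed.
Definition im : submodClosed V := submod im_subproof.

End KernelImage.

Section SubQuot.
Variables (R : pzRingType) (V : lmodType R) (A B : submodClosed V).

Lemma trace_subproof : submodule_pred (fun a : sub_mod A => sub_val a \in B).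
Proof.
split=> [|u v|a u]; rewrite ?rpred0 //; first exact: rpredD.
exact: rpredZ.
Qed.

(* A / B, used when B is contained in A *)
Definition subquot : lmodType R := quot_mod (submod trace_subproof).

End SubQuot.

Section Hom.
Variables (R : comPzRingType) (U V : lmodType R).

Lemma hom_subproof : submodule_pred (fun f : U -> V => linear f).
Proof.
split=> [|f g lf lg|a f lf] b u v.
- by rewrite scaler0 addr0.
- by rewrite ![(f + g) _]/(f _ + g _) lf lg scalerDr addrACA.
- rewrite -[LHS]/(a *: f (b *: u + v)) -[RHS]/(b *: (a *: f u) + a *: f v).
  by rewrite lf scalerDr !scalerA mulrC.
Qed.

Definition Hom : lmodType R := sub_mod (submod hom_subproof).

Lemma Hom_linear (f : Hom) : linear (sub_val f).
Proof. exact: elimT (submodP hom_subproof _) (sub_valP f). Qed.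

End Hom.

Section HomMap.
Variables (R : comPzRingType) (U V M : lmodType R) (d : {linear U -> V}).

Lemma hom_map_subproof (f : Hom V M) : sub_val f \o d \in submod (hom_subproof U M).
Proof. by apply/submodP => a u v /=; rewrite linearP Hom_linear. Qed.

Definition hom_map (f : Hom V M) : Hom U M :=
  SubMod (hom_map_subproof f).

Lemma hom_map_linear : linear hom_map.
Proof. by move=> a f g; apply: sub_val_inj. Qed.
HB.instance Definition _ :=
  GRing.isLinear.Build R (Hom V M) (Hom U M) *:%R hom_map hom_map_linear.

End HomMap.
Arguments hom_map {R U V} M d f.

Section Koszul.
Variables (R : comPzRingType) (n : nat) (x : n.-tuple R).

(* the free R-module on the symbols e_S, S a subset of {0, .., n-1} with i
   elements, i.e. the i-th exterior power of R^n *)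
Definition koszul_mod (i : nat) : lmodType R :=
  {ffun {S : {set 'I_n} | #|S| == i} -> R^o}.

(* The differential from degree i to degree i - 1:
     e_T |-> \sum_(k in T) (-1)^(position of k in T) x_k e_(T :\ k).
   In degree 0 the target is (by the convention 0.-1 = 0) [koszul_mod 0] instead
   of the zero module, and the map is zero because T is empty. *)
Definition koszul_d (i : nat) (c : koszul_mod i) : koszul_mod i.-1 :=
  [ffun S => \sum_(T : {T : {set 'I_n} | #|T| == i})
     \sum_(k in val T | val T :\ k == val S)
       (-1) ^+ #|[set j in val T | (j < k)%N]| * tnth x k * c T].

Lemma koszul_d_linear i : linear (@koszul_d i).
Proof.
move=> a c c'; apply/ffunP => S; rewrite !ffunE scaler_sumr -big_split.
apply: eq_bigr => T _; rewrite scaler_sumr -big_split.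
apply: eq_bigr => k _; rewrite !ffunE /= mulrDr; congr (_ + _).
by rewrite /GRing.scale /= mulrCA.
Qed.
HB.instance Definition _ i :=
  GRing.isLinear.Build R (koszul_mod i) (koszul_mod i.-1) *:%R
    (@koszul_d i) (@koszul_d_linear i).

(* H^i(x, M), the cohomology of Hom_R(K(x), M) *)
Definition koszul_coh (M : lmodType R) (i : nat) : lmodType R :=
  subquot (ker (hom_map M (@koszul_d i.+1)))
          (im (hom_map M (@koszul_d i))).

End Koszul.

Section Torsion.
Variables (R : comPzRingType).
Implicit Types (M N L : lmodType R) (T : lmodType R -> Prop).

Record direct_system (I : Type) (le : I -> I -> Prop) := DirectSystem {
  ds_obj : I -> lmodType R;
  ds_map : forall i j, le i j -> {linear ds_obj i -> ds_obj j};
  ds_id : forall i (h : le i i) v, ds_map h v = v;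
  ds_comp : forall i j k (hij : le i j) (hjk : le j k) (hik : le i k) v,
    ds_map hjk (ds_map hij v) = ds_map hik v }.

Definition directed (I : Type) (le : I -> I -> Prop) : Prop :=
  [/\ inhabited I, forall i, le i i,
      forall i j k, le i j -> le j k -> le i k &
      forall i j, exists k, le i k /\ le j k].

Definition cocone I le (D : @direct_system I le) L
    (f : forall i, {linear ds_obj D i -> L}) : Prop :=
  forall i j (h : le i j) v, f j (ds_map D h v) = f i v.

Definition is_direct_limit I le (D : @direct_system I le) L
    (f : forall i, {linear ds_obj D i -> L}) : Prop :=
  cocone f /\
  forall N (g : forall i, {linear ds_obj D i -> N}), cocone g ->
    exists u : {linear L -> N}, (forall i v, u (f i v) = g i v) /\
      forall u' : {linear L -> N}, (forall i v, u' (f i v) = g i v) -> u' =1 u.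

Record torsion_theory T : Prop := TorsionTheory {
  tt_iso : forall M N (f : {linear M -> N}), bijective f -> T M -> T N;
  tt_zero : forall M, (forall v : M, v = 0) -> T M;
  tt_sub : forall M (A : submodClosed M), T M -> T (sub_mod A);
  tt_quot : forall M (A : submodClosed M), T M -> T (quot_mod A);
  tt_ext : forall M (A : submodClosed M),
    T (sub_mod A) -> T (quot_mod A) -> T M;
  tt_lim : forall (I : Type) (le : I -> I -> Prop) (D : direct_system le) L
      (f : forall i, {linear ds_obj D i -> L}),
    directed le -> is_direct_limit f -> (forall i, T (ds_obj D i)) -> T L }.

Definition prime_ideal (p : submodClosed R^o) : Prop :=
  (1 : R^o) \notin p /\
  forall a b : R, (a * b : R^o) \in p -> (a : R^o) \in p \/ (b : R^o) \in p.

Lemma ann_subproof M (m : M) : submodule_pred (fun a : R^o => (a : R) *: m = 0).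
Proof.
split=> [|a b|c a]; rewrite ?scale0r //.
  by rewrite scalerDl => -> ->; rewrite addr0.
by rewrite -scalerA => ->; rewrite scaler0.
Qed.
Definition ann M (m : M) : submodClosed R^o := submod (ann_subproof m).

Definition minimal_prime_over (I p : submodClosed R^o) : Prop :=
  [/\ prime_ideal p, {subset I <= p} &
      forall q : submodClosed R^o, prime_ideal q ->
        {subset I <= q} -> {subset q <= p} -> {subset p <= q}].

Definition wAss M : set (submodClosed R^o) :=
  [set p | exists m : M, minimal_prime_over (ann m) p].

Definition half_centered T : Prop :=
  forall M, (forall p, wAss M p -> T (quot_mod p)) -> T M.

Definition weakly_laskerian M : Prop :=
  forall A : submodClosed M, finite_set (wAss (quot_mod A)).

Lemma smul_subproof (s : seq R) M : submodule_pred (fun v : M =>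
  exists m : 'I_(size s) -> M, v = \sum_(i < size s) s`_i *: m i).
Proof.
split=> [|_ _ [f ->] [g ->]|a _ [f ->]].
- by exists (fun=> 0); rewrite big1 // => i _; rewrite scaler0.
- exists (fun i => f i + g i); rewrite -big_split.
  by apply: eq_bigr => i _; rewrite scalerDr.
- exists (fun i => a *: f i).
  by rewrite scaler_sumr; apply: eq_bigr => i _; rewrite !scalerA mulrC.
Qed.
(* (s_0, .., s_(k-1)) M *)
Definition smul (s : seq R) M : submodClosed M := submod (smul_subproof s M).

Definition ideal_gen (s : seq R) : submodClosed R^o := smul s R^o.

Lemma colon_subproof M (A : submodClosed M) (a : R) :
  submodule_pred (fun v : M => a *: v \in A).
Proof.
split=> [|u v|b u]; rewrite ?scaler0 ?rpred0 //.
  by rewrite scalerDr; apply: rpredD.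
by rewrite scalerA mulrC -scalerA; apply: rpredZ.
Qed.
(* (A :_M a) *)
Definition colon M (A : submodClosed M) (a : R) : submodClosed M :=
  submod (colon_subproof A a).

Definition weak_regular T M (s : seq R) : Prop :=
  forall i, (i < size s)%N ->
    T (subquot (colon (smul (take i s) M) s`_i) (smul (take i s) M)).

(* Grades take values in the extended integers, where every set has a supremum
   and an infimum.  The first argument of [supremum] and [infimum] is the value
   at the empty set. *)
Definition c_grade T (a : submodClosed R^o) M : \bar int :=
  supremum 0%:E [set (size s)%:Z%:E | s in
    [set s : seq R | {in s, forall y, (y : R^o) \in a} /\ weak_regular T M s]].

Definition K_grade T n (x : n.-tuple R) M : \bar int :=
  infimum +oo%E [set i%:Z%:E | i in [set i : nat | ~ T (koszul_coh x M i)]].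

End Torsion.

(* Main.v *)
(* A half centered torsion theory T is the class of modules M such that M_p = 0
   for every prime p with R/p outside T, so every membership in T can be tested
   at one prime p at a time, clearing denominators outside p.  Koszul cohomology
   of M/N is computed with cochains in M modulo a submodule N, so the induction
   on the length of a sequence replaces N by N + yM and no quotient of M is
   needed.  For y in (x) with ((N : y)/N)_p = 0, the homotopy between
   multiplication by y and 0 on the Koszul complex transfers the vanishing of
   H^i(x, M/(N + yM))_p to H^(i+1)(x, M/N)_p, and d^2 = 0 gives the converse
   direction.  A suitable y exists when H^0(x, M/N)_p = 0 for all these p: none
   of the finitely many weakly associated primes p of M/N with R/p outside T
   contains (x), as a power of each generator would kill, up to factors outside
   p, the element over whose annihilator p is minimal; then apply prime
   avoidance. *)

From HB Require Import structures.
Require Import Defs.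
From mathcomp Require Import all_boot all_order all_algebra.
From mathcomp Require Import ring_quotient generic_quotient.
From mathcomp Require Import boolp classical_sets functions cardinality.
From mathcomp Require Import constructive_ereal.

Set Implicit Arguments.
Unset Strict Implicit.
Unset Printing Implicit Defensive.

Import GRing.Theory.

Local Open Scope ring_scope.

(** * Membership of sums in submodules *)

Section Submodules.
Variables (R : pzRingType) (V : lmodType R) (N : submodClosed V).
Implicit Types u v : V.

Lemma submod_memN u : u \in N -> - u \in N.
Proof. by rewrite -scaleN1r => uN; apply: rpredZ. Qed.

Lemma submod_memDl u v : u \in N -> (u + v \in N) = (v \in N).
Proof.
move=> uN; apply/idP/idP => [uvN|]; last exact: rpredD.
by rewrite -(addKr u v) rpredD // submod_memN.
Qed.

Lemma submod_memDr u v : v \in N -> (u + v \in N) = (u \in N).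
Proof. by rewrite addrC; apply: submod_memDl. Qed.

End Submodules.

(** * Existence of primes, minimal primes and prime avoidance *)

Section Primes.
Variable R : comPzRingType.
Implicit Types (p q I : submodClosed R^o) (x y s : R).

Lemma prime_notinM p x y :
  prime_ideal p -> (x : R^o) \notin p -> (y : R^o) \notin p ->
  (x * y : R^o) \notin p.
Proof. by move=> [_ hp] /negP hx /negP hy; apply/negP => /hp[]. Qed.

Lemma ideal_memMl I x y : (y : R^o) \in I -> (x * y : R^o) \in I.
Proof. exact: (@rpredZ R R^o I x y). Qed.

Lemma ideal_memMr I x y : (x : R^o) \in I -> (x * y : R^o) \in I.
Proof. by rewrite mulrC; apply: ideal_memMl. Qed.

(** An ideal maximal among those containing [I] and missing [S] is prime: if it contains neither [b]
    nor [c], then adding multiples of [b], respectively [c], to its elements reaches [S], and the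
    product of the two elements reached would lie in the ideal if [b * c] did. *)
Lemma exists_prime_disjoint (S : R -> Prop) I :
  S 1 -> (forall x y, S x -> S y -> S (x * y)) ->
  (forall x, S x -> (x : R^o) \notin I) ->
  exists2 q, prime_ideal q &
    {subset I <= q} /\ forall x, S x -> (x : R^o) \notin q.
Proof.
move=> S1 SM SI.
pose P (X : set R^o) := X = set0 \/
  [/\ submodule_pred X, (forall x, x \in I -> X x) & forall x, S x -> ~ X x].
have [F FP Ftot|A [PA Amax]] := @Zorn_bigcup R^o P.
  have [[X0 [FX0 [x0 X0x0]]]|F0] :=
    pselect (exists X, F X /\ (X !=set0)%classic); last first.
    left; apply/seteqP; split => // x [X FX Xx]; apply: F0.
    by exists X; split => //; exists x.
  have good X : F X -> (X !=set0)%classic ->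
      [/\ submodule_pred X, (forall x, x \in I -> X x) & forall x, S x -> ~ X x].
    by move=> FX [x Xx]; case: (FP X FX) => // X0E; rewrite X0E in Xx.
  have [[X00 _ _] X0I _] := good _ FX0 (ex_intro _ _ X0x0).
  right; split.
  - split.
    + by exists X0.
    + move=> u v [X FX Xu] [Y FY Yv].
      have [[_ XD _] _ _] := good _ FX (ex_intro _ _ Xu).
      have [[_ YD _] _ _] := good _ FY (ex_intro _ _ Yv).
      case: (Ftot X Y FX FY) => XY.
        by exists Y => //; apply: YD => //; apply: XY.
      by exists X => //; apply: XD => //; apply: XY.
    + move=> c v [X FX Xv]; exists X => //.
      by have [[_ _ XZ] _ _] := good _ FX (ex_intro _ _ Xv); apply: XZ.
  - by move=> x xI; exists X0 => //; apply: X0I.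
  - move=> x Sx [X FX Xx].
    by have [_ _ XS] := good _ FX (ex_intro _ _ Xx); apply: XS Xx.
have PI : P (fun x => x \in I).
  right; split=> // [|x Sx]; last by apply/negP/SI.
  by split=> [|u v|c v]; [exact: rpred0|exact: rpredD|exact: rpredZ].
case: PA => [A0|[Asub AI AS]].
  exfalso; apply: (Amax (fun x => x \in I)) => //; rewrite A0; split => //.
  by move/(_ 0 (rpred0 I)).
pose q := submod Asub; exists q; last first.
  split=> [x xI|x Sx]; first by apply/submodP/AI.
  by apply/negP => /submodP; apply: AS.
have [A0 AD AZ] := Asub.
split; first by apply/negP => /submodP; apply: AS.
(* Otherwise the ideal [A + R b] would still miss [S], against maximality. *)
have ext b : ~ A b -> exists x c, A x /\ S (x + c * b).
  move=> Ab; apply: contrapT => H.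
  pose B (z : R^o) := exists x c, A x /\ z = x + c * b.
  apply: (Amax B); first split.
  - by move=> z Az; exists z, 0; split=> //; rewrite mul0r addr0.
  - move=> BA; apply/Ab/BA; exists 0, 1; split => //.
    by rewrite mul1r add0r.
  right; split.
  - split.
    + by exists 0, 0; split=> //; rewrite mul0r addr0.
    + move=> _ _ [x [c [Ax ->]]] [x' [c' [Ax' ->]]].
      exists (x + x'), (c + c'); split; first exact: AD.
      by rewrite mulrDl addrACA.
    + move=> d _ [x [c [Ax ->]]]; exists (d * x), (d * c); split.
        exact: (AZ d x).
      by rewrite /GRing.scale /= mulrDr mulrA.
  - by move=> x xI; exists x, 0; rewrite mul0r addr0; split=> //; apply: AI.
  - by move=> z Sz [x [c [Ax E]]]; apply: H; exists x, c; rewrite -E.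
move=> b c /(submodP Asub) Abc.
apply: contrapT => /not_orP[nb nc].
have Ab : ~ A b by move=> ?; apply/nb/submodP.
have Ac : ~ A c by move=> ?; apply/nc/submodP.
have [x [d [Ax Sx]]] := ext _ Ab; have [y [e [Ay Sy]]] := ext _ Ac.
apply: (AS _ (SM _ _ Sx Sy)).
rewrite mulrDl !mulrDr; apply: (AD); apply: (AD).
- exact: (AZ x y).
- by rewrite mulrC; exact: (AZ _ x).
- exact: (AZ (d * b) y).
- by rewrite mulrACA; exact: (AZ (d * e) (b * c)).
Qed.

(** Otherwise the multiplicative set of all [s * x ^+ k] with [s] outside [p] misses [I]; a prime
    over [I] disjoint from it lies in [p] and omits [x], against minimality. *)
Lemma minimal_prime_expr I p x :
  minimal_prime_over I p -> (x : R^o) \in p ->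
  exists s k, (s : R^o) \notin p /\ (s * x ^+ k : R^o) \in I.
Proof.
move=> [pp Ip pmin] xp; apply: contrapT => H.
pose S z := exists s k, (s : R^o) \notin p /\ z = s * x ^+ k.
have [||z [s [k [sp ->]]]|q qp [Iq Sq]] := @exists_prime_disjoint S I.
- by exists 1, 0%N; rewrite mulr1; case: pp.
- move=> _ _ [s [k [sp ->]]] [t [l [tp ->]]]; exists (s * t), (k + l)%N.
  by rewrite exprD mulrACA; split=> //; apply: prime_notinM.
- by apply/negP => hI; apply: H; exists s, k.
have qsub : {subset q <= p}.
  move=> z zq; apply: contraPP zq => /negP zp; apply/negP/Sq.
  by exists z, 0%N; rewrite mulr1.
have /negP[] : (x : R^o) \notin q.
  apply: Sq; exists 1, 1%N; rewrite mul1r expr1; split => //.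
  by case: pp.
exact: pmin xp.
Qed.

Lemma prime_avoidance I (ps : seq {classic submodClosed R^o}) :
  (forall p : submodClosed R^o, p \in ps -> prime_ideal p /\ ~ {subset I <= p}) ->
  exists2 y, (y : R^o) \in I &
    forall p : submodClosed R^o, p \in ps -> (y : R^o) \notin p.
Proof.
elim: ps => [|p ps IH] H; first by exists 0; rewrite ?rpred0.
have [|y yI yps] := IH; first by move=> q qps; apply: H; apply/predU1P; right.
have [pp pI] := H p (mem_head _ _).
case: (boolP ((y : R^o) \in p)) => yp; last first.
  by exists y => // q /predU1P[->//|]; apply: yps.
have [z zI zp] : exists2 z : R^o, z \in I & z \notin p.
  apply: contrapT => nz; apply: pI => z zI; apply: contrapT => /negP zp.
  by apply: nz; exists z.
(* Here [y] lies in [p]. The correction [w] moves it out of [p], hence out of every prime inside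
   [p], and changes nothing modulo the other primes; it is [z] times an element of [q] outside [p]
   for each such [q]. *)
have [w [wI wp wps]] : exists w : R, [/\ (w : R^o) \in I, (w : R^o) \notin p &
    forall q : submodClosed R^o, q \in ps -> ~ {subset q <= p} -> (w : R^o) \in q].
  elim: ps {IH H yps} => [|q ps [w [wI wp wps]]]; first by exists z.
  have [qp|/existsNP[c /not_implyP[cq /negP cp]]] := pselect {subset q <= p}.
    by exists w; split=> // r /predU1P[->//|]; apply: wps.
  exists (c * w); split; [exact: ideal_memMl|exact: prime_notinM|].
  move=> r /predU1P[-> _|rps rp]; first exact: ideal_memMr.
  by apply/ideal_memMl/wps.
exists (y + w); first exact: (@rpredD R^o I).
have ywp : (y + w : R^o) \notin p by rewrite (submod_memDl _ yp).
move=> q /predU1P[->//|qps]; have [qp|qp] := pselect {subset q <= p}.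
  by apply: contra ywp => /qp.
by rewrite (submod_memDr _ (wps q qps qp)) yps.
Qed.

End Primes.

(** * Half centered torsion theories tested at primes *)

Section TorsionTheory.
Variables (R : comPzRingType) (T : lmodType R -> Prop).
Hypothesis tT : torsion_theory T.
Implicit Types M N : lmodType R.

Lemma torsion_bij M N (f : M -> N) :
  linear f -> injective f -> (forall v, exists u, f u = v) -> T M -> T N.
Proof.
move=> flin finj fsurj; pose g v := sval (cid (fsurj v)).
have gK v : f (g v) = v by rewrite /g; case: cid.
pose F : {linear M -> N} := HB.pack f (GRing.isLinear.Build R M N *:%R f flin).
apply: (tt_iso tT (f := F)).
by exists g => // u; apply: finj; rewrite gK.
Qed.

Lemma torsion_inj M N (f : {linear M -> N}) : injective f -> T N -> T M.
Proof.
move=> finj TN.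
pose g (w : sub_mod (im f)) : M :=
  sval (cid (elimT (submodP (im_subproof f) _) (sub_valP w))).
have gK w : f (g w) = sub_val w by rewrite /g; case: cid.
apply: (@torsion_bij (sub_mod (im f)) M g); last exact: (tt_sub tT).
- by move=> a u v; apply: finj; rewrite linearP !gK.
- by move=> u v E; apply: sub_val_inj; rewrite -!gK E.
- move=> m; have fm : f m \in im f by apply/submodP; exists m.
  by exists (SubMod fm); apply: finj; rewrite gK.
Qed.

Lemma torsion_surj M N (f : {linear M -> N}) :
  (forall v, exists u, f u = v) -> T M -> T N.
Proof.
move=> fsurj TM.
pose g (w : quot_mod (ker f)) : N := f (repr (w : Quotient.quot (zcarrier (ker f)))).
have gK u : g (quot_proj (ker f) u) = f u.
  rewrite /g; apply/eqP; rewrite -subr_eq0 -linearB; apply/eqP.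
  by apply/(submodP (ker_subproof f))/quot_projP; rewrite quot_reprK.
apply: (@torsion_bij (quot_mod (ker f)) N g); last exact: (tt_quot tT).
- move=> a u v; rewrite -(quot_reprK u) -(quot_reprK v) -linearP !gK.
  by rewrite linearP.
- move=> u v; rewrite -(quot_reprK u) -(quot_reprK v) !gK => E.
  apply/quot_projP/submodP.
  by rewrite linearB E subrr.
- move=> w; have [u <-] := fsurj w.
  by exists (quot_proj (ker f) u).
Qed.

Lemma torsion_quot_subset (I J : submodClosed R^o) :
  {subset I <= J} -> T (quot_mod I) -> T (quot_mod J).
Proof.
move=> IJ; pose f (w : quot_mod I) : quot_mod J :=
  quot_proj J (repr (w : Quotient.quot (zcarrier I))).
have fK u : f (quot_proj I u) = quot_proj J u.
  by rewrite /f; apply/quot_projP/IJ/quot_projP; rewrite quot_reprK.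
have flin : linear f.
  by move=> a u v; rewrite -(quot_reprK u) -(quot_reprK v) -linearP !fK linearP.
pose F : {linear quot_mod I -> quot_mod J} :=
  HB.pack f (GRing.isLinear.Build R _ _ *:%R f flin).
apply: (torsion_surj (f := F)) => w.
exists (quot_proj I (repr (w : Quotient.quot (zcarrier J)))).
by rewrite /= fK quot_reprK.
Qed.

(** The map sending [a] to [a *: m] embeds R/ann(m) in [M]. *)
Lemma torsion_ann M (m : M) : T M -> T (quot_mod (ann m)).
Proof.
pose f (w : quot_mod (ann m)) : M :=
  (repr (w : Quotient.quot (zcarrier (ann m))) : R) *: m.
have fK (u : R^o) : f (quot_proj (ann m) u) = (u : R) *: m.
  rewrite /f; apply/eqP; rewrite -subr_eq0 -scalerBl; apply/eqP.
  by apply/(submodP (ann_subproof m))/quot_projP; rewrite quot_reprK.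
have flin : linear f.
  move=> a u v; rewrite -(quot_reprK u) -(quot_reprK v) -linearP !fK.
  by rewrite scalerDl scalerA.
pose F : {linear quot_mod (ann m) -> M} :=
  HB.pack f (GRing.isLinear.Build R _ _ *:%R f flin).
apply: (torsion_inj (f := F)) => u v.
rewrite -(quot_reprK u) -(quot_reprK v) /= !fK => E.
by apply/quot_projP/submodP; rewrite scalerBl E subrr.
Qed.

(** For a prime [p] this says that the localization of [M] at [p] is zero, without constructing
    it. *)
Definition vanishes_at (p : submodClosed R^o) M :=
  forall m : M, exists2 s : R, (s : R^o) \notin p & s *: m = 0.

(** If no element outside [p] kills [m], then R/p is a quotient of R/ann(m), which embeds in [M].
    Conversely, a weakly associated prime contains some [ann m], so [M] does not vanish there and
    R/p must be torsion. *)
Lemma half_centeredP (hT : half_centered T) M :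
  T M <-> forall p, prime_ideal p -> ~ T (quot_mod p) -> vanishes_at p M.
Proof.
split=> [TM p pp Tp m|H].
  apply: contrapT => nm; apply: Tp.
  apply: torsion_quot_subset (torsion_ann m TM) => s /(submodP (ann_subproof m)) sm.
  by apply: contrapT => /negP sp; apply: nm; exists s.
apply: hT => p [m [pp mp _]]; apply: contrapT => Tp.
have [s /negP sp sm] := H p pp Tp m.
by apply/sp/mp/submodP.
Qed.

End TorsionTheory.

(** * Koszul cochains and the contracting homotopy *)

Section Cochains.
Variables (R : comPzRingType) (n : nat) (x : n.-tuple R) (M : lmodType R).
Implicit Types (A : {set 'I_n}) (c : {set 'I_n} -> M) (N : submodClosed M).

Definition pos_sign A (k : 'I_n) : R := (-1) ^+ #|[set j in A | (j < k)%N]|.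

Lemma pos_signD1 A j k : j \in A ->
  pos_sign A k = (-1) ^+ (j < k)%N * pos_sign (A :\ j) k.
Proof.
move=> jA; rewrite /pos_sign -exprD; congr (_ ^+ _).
rewrite (cardsD1 j) inE jA; congr (_ + _)%N.
by apply: eq_card => l; rewrite !inE andbA.
Qed.

Lemma pos_sign_sqr A k : pos_sign A k * pos_sign A k = 1.
Proof. by rewrite -expr2 sqrr_sign. Qed.

(* Ungraded form of the cochain complex Hom(K(x), M): a cochain is a function on
   all subsets of {0, .., n-1}, and its part of degree i consists of its values
   at the subsets with i elements. *)
Definition cobound c A : M :=
  \sum_(k in A) (pos_sign A k * tnth x k) *: c (A :\ k).

Lemma cobound_linear : linear (cobound : _ -> {set 'I_n} -> M).
Proof.
move=> a c d; apply/funext => A.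
rewrite -[RHS]/(a *: cobound c A + cobound d A) /cobound.
rewrite scaler_sumr -big_split; apply: eq_bigr => k _ /=.
by rewrite -[(a *: c + d) _]/(a *: c _ + d _) scalerDr !scalerA [a * _]mulrC.
Qed.
HB.instance Definition _ := GRing.isLinear.Build R
  ({set 'I_n} -> M) ({set 'I_n} -> M) *:%R cobound cobound_linear.

Lemma cobound_mem N c A i : #|A| = i.+1 ->
  (forall B : {set _}, #|B| = i -> c B \in N) -> cobound c A \in N.
Proof.
move=> Ai cN; apply: rpred_sum => k kA; apply/rpredZ/cN.
by move: Ai; rewrite (cardsD1 k) kA => -[].
Qed.

Lemma cobound0 c A : #|A| = 0%N -> cobound c A = 0.
Proof. by move/cards0_eq => ->; rewrite /cobound big_set0. Qed.

(** Removing [k] then [j], or [j] then [k], gives the same subset with opposite signs, so the double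
    sum is a sum minus its transpose. *)
Lemma cobound_cobound c A : cobound (cobound c) A = 0.
Proof.
pose F k j := (pos_sign A k * pos_sign (A :\ k) j * (tnth x k * tnth x j)) *:
  c (A :\ k :\ j).
have FN k j : k \in A -> j \in A -> (j < k)%N -> F k j = - F j k.
  move=> kA jA jk; rewrite /F (pos_signD1 k jA) (pos_signD1 j kA) jk.
  rewrite ltnNge (ltnW jk) mul1r expr1 mulN1r !mulNr scaleNr.
  rewrite ![A :\ _ :\ _]finset.setDDl finset.setUC; congr (- (_ *: _)).
  by rewrite [tnth x k * _]mulrC [pos_sign _ k * _]mulrC.
have -> : cobound (cobound c) A =
    \sum_k \sum_j (if [&& k \in A, j \in A & j != k] then F k j else 0).
  rewrite /cobound big_mkcond; apply: eq_bigr => k _.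
  case: ifP => kA; last by rewrite big1.
  rewrite scaler_sumr big_mkcond; apply: eq_bigr => j _.
  rewrite !inE andbC /=; case: ifP => // _.
  by rewrite scalerA mulrACA.
pose G (k j : 'I_n) := if [&& k \in A, j \in A & (j < k)%N] then F k j else 0.
have GE k j : (if [&& k \in A, j \in A & j != k] then F k j else 0) =
    G k j - G j k.
  rewrite /G; case: (boolP (k \in A)) => kA; last by rewrite andbF subr0.
  case: (boolP (j \in A)) => jA; last by rewrite subr0.
  rewrite /= -val_eqE /=; case: ltngtP => jk; rewrite ?subr0 ?subrr //.
  by rewrite (FN j k) // opprK add0r.
under eq_bigr => k _ do under eq_bigr => j _ do rewrite GE.
under eq_bigr => k _ do rewrite sumrB.
by rewrite sumrB [X in _ - X]exchange_big subrr.
Qed.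

(** The dual of exterior multiplication by e_k: the value at e_A is that of [c] at the product of
    e_k and e_A. *)
Definition contraction k c A : M :=
  if k \in A then 0 else pos_sign A k *: c (k |: A).

(** If [k] is in [A], only the removal of [k] contributes. Otherwise the terms removing some [j] in
    [A] cancel between the two summands, and the removal of [k] from [k |: A] remains. *)
Lemma contraction_homotopy k c A :
  cobound (contraction k c) A + contraction k (cobound c) A = tnth x k *: c A.
Proof.
rewrite {2}/contraction; case: ifP => kA.
  rewrite addr0 /cobound (bigD1 k) //= big1 ?addr0 => [|j /andP[jA jk]]; last first.
    by rewrite /contraction !inE kA eq_sym jk /= scaler0.
  rewrite /contraction !inE eqxx /= finset.setD1K // scalerA.
  rewrite (pos_signD1 k kA) ltnn mul1r mulrC mulrA.
  by rewrite pos_sign_sqr mul1r.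
rewrite {2}/cobound (bigD1 k) ?setU11 //= scalerDr scalerA.
rewrite (pos_signD1 k (finset.setU11 _ _)) ltnn mul1r finset.setU1K ?kA //.
rewrite mulrA pos_sign_sqr mul1r addrCA -[RHS]addr0; congr (_ + _).
rewrite scaler_sumr.
rewrite (eq_bigl (fun j => j \in A)) => [|j]; last first.
  by rewrite !inE; case: eqVneq => [->|]; rewrite ?kA ?andbT.
rewrite -big_split big1 //= => j jA.
have jk : j != k by apply: contraFneq kA => <-.
rewrite /contraction !inE kA andbF !scalerA (pos_signD1 k jA).
have -> : (k |: A) :\ j = k |: A :\ j.
  by apply/setP => i; rewrite !inE; case: eqVneq => // ->; rewrite (negPf jk).
rewrite (pos_signD1 (A := k |: A) j (finset.setU11 _ _)) finset.setU1K ?kA //.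
rewrite -scalerDl -[RHS](scale0r (c (k |: A :\ j))); congr (_ *: _).
rewrite [X in X + _]mulrC.
by case: (ltngtP j k) jk => [_ _|_ _|/val_inj->]; rewrite ?eqxx //= expr0 expr1 mul1r
  !mulN1r !mulNr ?mulrN ?addrN.
Qed.

(** Writing [y] as a combination of the entries of [x], the same combination of contractions of [c]
    serves as [e]; the error is a combination of contractions of [cobound x c], hence in [N]. *)
Lemma cobound_homotopy N i c (y : R) :
  (y : R^o) \in ideal_gen x ->
  (forall A : {set _}, #|A| = i.+1 -> cobound c A \in N) ->
  exists e, forall A : {set _}, #|A| = i -> y *: c A - cobound e A \in N.
Proof.
move=> /(submodP (smul_subproof x R^o))[a ->] dcN.
pose s (k : 'I_(size x)) : 'I_n := cast_ord (size_tuple x) k.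
exists (\sum_k a k *: contraction (s k) c) => A Ai.
have -> : cobound (\sum_k a k *: contraction (s k) c) A =
    \sum_k a k *: cobound (contraction (s k) c) A.
  rewrite (linear_sum cobound) fct_sumE; apply: eq_bigr => k _.
  by rewrite (linearZ_LR cobound).
rewrite scaler_suml -sumrB; apply: rpred_sum => k _.
have -> : (x`_k *: a k : R) = a k * tnth x (s k).
  by rewrite (tnth_nth 0) /= mulrC.
rewrite -scalerA -contraction_homotopy scalerDr addrC addKr; apply: rpredZ.
rewrite /contraction; case: ifP => kA; first exact: rpred0.
by apply/rpredZ/dcN; rewrite cardsU1 kA Ai.
Qed.

End Cochains.

(** * Local vanishing of Koszul cohomology modulo N and modulo N + yM *)

Section LocalCohomologyVanishing.
Variables (R : comPzRingType) (n : nat) (x : n.-tuple R) (M : lmodType R).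
Variable p : submodClosed R^o.
Hypothesis pp : prime_ideal p.
Implicit Types (A B : {set 'I_n}) (b c e f : {set 'I_n} -> M).
Implicit Types (N : submodClosed M) (v : M) (u y : R).

Lemma coboundB c e A : cobound x (c - e) A = cobound x c A - cobound x e A.
Proof. by rewrite (linearB (cobound x (M:=M))). Qed.

Lemma coboundZ u c A : cobound x (u *: c) A = u *: cobound x c A.
Proof. by rewrite (linearZ_LR (cobound x (M:=M))). Qed.

Definition local_mem N v := exists2 u, (u : R^o) \notin p & u *: v \in N.

(** The product of the finitely many denominators is a common one, outside [p] by primality. *)
Lemma local_mem_uniform N (I : finType) (P : pred I) (w : I -> M) :
  (forall i, P i -> local_mem N (w i)) ->
  exists2 u, (u : R^o) \notin p & forall i, P i -> u *: w i \in N.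
Proof.
move=> H.
have [g gP] : exists g : I -> R, forall i,
    (g i : R^o) \notin p /\ (P i -> g i *: w i \in N).
  suff /choice[g gP] : forall i, exists u : R,
      (u : R^o) \notin p /\ (P i -> u *: w i \in N) by exists g.
  move=> i; have [Pi|nPi] := boolP (P i); last by exists 1; case: pp.
  by have [u up uN] := H i Pi; exists u.
exists (\prod_i g i) => [|i Pi].
  elim/big_ind: _ => //; [by case: pp|by move=> *; apply: prime_notinM|].
  by move=> i _; case: (gP i).
rewrite (bigD1 i) //= mulrC -scalerA; apply: rpredZ.
by case: (gP i) => _; apply.
Qed.

(* The localization at [p] of the [i]-th Koszul cohomology of [M / N] is zero. *)
Definition local_coh0 N i := forall c,
  (forall A, #|A| = i.+1 -> cobound x c A \in N) ->
  exists2 u, (u : R^o) \notin p &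
    exists b, forall A, #|A| = i -> u *: c A - cobound x b A \in N.

(** Equivalently, ((N : y)/N)_p = 0: multiplication by [y] is injective on (M/N)_p. *)
Definition local_regular N y := forall v, y *: v \in N -> local_mem N v.

Section Step.
Variables (N N' : submodClosed M) (y : R).
Hypothesis y_regular : local_regular N y.
(* [N' = N + y M] *)
Hypothesis N'P : forall v, v \in N' <-> exists v', v - y *: v' \in N.

Lemma cobound_lift (P : pred {set 'I_n}) c :
  (forall A, P A -> c A \in N') ->
  exists f, forall A, P A -> c A - y *: f A \in N.
Proof.
move=> cN'; suff /choice[f fP] :
    forall A, exists v, P A -> c A - y *: v \in N by exists f.
move=> A; have [PA|] := boolP (P A); last by exists 0.
by have /N'P[v vN] := cN' A PA; exists v.
Qed.

(** Coboundaries vanish in degree 0, so the homotopy puts [y *: c] in [N], and regularity cancels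
    [y]. *)
Lemma local_coh0_0 : (y : R^o) \in ideal_gen x -> local_coh0 N 0.
Proof.
move=> yx c dc; have [e ye] := cobound_homotopy yx dc.
have [|u up uc] := @local_mem_uniform N _ (fun A => #|A| == 0%N) c.
  move=> A /eqP A0; apply: y_regular.
  by have := ye A A0; rewrite (cobound0 _ _ A0) subr0.
exists u => //; exists 0 => A A0.
by rewrite (cobound0 _ _ A0) subr0; apply: uc; rewrite A0.
Qed.

(** Write d for [cobound x]. The homotopy gives y c = d e modulo [N], so [e] is a cocycle modulo
    [N'] and u e = d b + y f modulo [N]. Applying d gives y (u c - d f) = 0 modulo [N], and
    regularity cancels [y]. *)
Lemma local_coh0_up i : (y : R^o) \in ideal_gen x ->
  local_coh0 N' i -> local_coh0 N i.+1.
Proof.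
move=> yx H c dc; have [e ye] := cobound_homotopy yx dc.
have [|u up [b ub]] := H e.
  move=> A Ai; apply/N'P; exists (c A).
  by rewrite -opprB submod_memN // ye.
have [f fN] := @cobound_lift (fun A => #|A| == i) (u *: e - cobound x b)
  (fun A Ai => ub A (eqP Ai)).
have dN A : #|A| = i.+1 -> y *: (u *: c A - cobound x f A) \in N.
  move=> Ai; have : cobound x (u *: e - cobound x b - y *: f) A \in N.
    by apply: (@cobound_mem _ _ x M N _ A _ Ai) => B /eqP; apply: fN.
  rewrite !coboundB !coboundZ cobound_cobound subr0 => h.
  have := rpredD (rpredZ u (ye A Ai)) h.
  by rewrite !scalerBr addrA subrK !scalerA [y * u]mulrC.
have [|w wp wN] := @local_mem_uniform N _ (fun A => #|A| == i.+1)
    (fun A => u *: c A - cobound x f A).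
  by move=> A /eqP Ai; apply/y_regular/dN.
exists (w * u); first exact: prime_notinM.
exists (w *: f) => A Ai; rewrite coboundZ -scalerA -scalerBr.
by apply: wN; rewrite Ai.
Qed.

(** Up to denominators: a cocycle [c] modulo [N'] has d c = y f modulo [N], so y d f = 0 and, by
    regularity, d f = 0 there. Vanishing in degree i + 1 gives f = d b; then c - y b is a cocycle
    modulo [N], hence a coboundary, and it agrees with [c] modulo [N']. *)
Lemma local_coh0_down i :
  local_coh0 N i -> local_coh0 N i.+1 -> local_coh0 N' i.
Proof.
move=> H0 H1 c dc.
have [f fN] := @cobound_lift (fun A => #|A| == i.+1) (cobound x c)
  (fun A Ai => dc A (eqP Ai)).
have [|u up uN] := @local_mem_uniform N _ (fun A => #|A| == i.+2) (cobound x f).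
  move=> A /eqP Ai; apply: y_regular.
  have : cobound x (cobound x c - y *: f) A \in N.
    by apply: (@cobound_mem _ _ x M N _ A _ Ai) => B /eqP; apply: fN.
  by rewrite coboundB coboundZ cobound_cobound sub0r => /submod_memN; rewrite opprK.
have [|u' u'p [b bN]] := H1 (u *: f).
  by move=> A Ai; rewrite coboundZ; apply: uN; rewrite Ai.
have [|w wp [b' b'N]] := H0 ((u' * u) *: c - y *: b).
  move=> A Ai; rewrite coboundB !coboundZ.
  have := rpredD (rpredZ (u' * u) (fN A (introT eqP Ai))) (rpredZ y (bN A Ai)).
  rewrite -[(u *: f) A]/(u *: f A) !scalerBr addrA !scalerA.
  by rewrite [y * _]mulrC subrK.
exists (w * (u' * u)); first by do 2?apply: prime_notinM.
exists b' => A Ai; apply/N'P; exists (w *: b A).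
have := b'N A Ai.
rewrite -[((u' * u) *: c - y *: b) A]/((u' * u) *: c A - y *: b A).
by rewrite scalerBr !scalerA [y * w]mulrC addrAC.
Qed.

End Step.
End LocalCohomologyVanishing.

(** * Subquotients, annihilators and the submodules (s)M *)

Section Quotients.
Variables (R : comPzRingType) (M : lmodType R) (p : submodClosed R^o).
Implicit Types (A N : submodClosed M) (v : M).

Lemma quot_proj_eq0 (V : lmodType R) (N : submodClosed V) (v : V) :
  quot_proj N v = 0 <-> v \in N.
Proof.
rewrite -[v in v \in N]subr0 -(linear0 (quot_proj N)).
by split => /quot_projP.
Qed.

Lemma vanishes_at_subquot A N :
  vanishes_at p (subquot A N) <-> forall v, v \in A -> local_mem p N v.
Proof.
split=> [H v vA|H w].
  have [u up] := H (quot_proj _ (SubMod vA)).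
  rewrite -linearZ => /quot_proj_eq0/(submodP (trace_subproof _ _)).
  by exists u.
rewrite -(quot_reprK w); set v := repr _.
have [u up uN] := H (sub_val v) (sub_valP v).
exists u => //; rewrite -linearZ; apply/quot_proj_eq0.
exact/(submodP (trace_subproof _ _)).
Qed.

Lemma ann_quot_proj (V : lmodType R) (N : submodClosed V) (v : V) (a : R) :
  ((a : R^o) \in ann (quot_proj N v)) = (a *: v \in N).
Proof.
apply/(submodP (ann_subproof _))/idP; rewrite -linearZ.
  by move/quot_proj_eq0.
by move=> ?; apply/quot_proj_eq0.
Qed.

(** The subquotient A/N embeds in M/N, and annihilators of elements are the same in both. *)
Lemma wAss_subquot A N : wAss (subquot A N) p ->
  exists v, v \in A /\ minimal_prime_over (ann (quot_proj N v)) p.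
Proof.
move=> [w]; rewrite -(quot_reprK w); set v := repr _ => -[pp mp pmin].
exists (sub_val v); split; first exact: sub_valP.
have E : ann (quot_proj (submod (trace_subproof A N)) v) =i
    ann (quot_proj N (sub_val v)).
  move=> a; rewrite !ann_quot_proj.
  by apply/(submodP (trace_subproof _ _))/idP.
split=> // [a|q qp aq]; first by rewrite -E; apply: mp.
by apply: pmin => // a; rewrite E; apply: aq.
Qed.

(** Coefficients indexed by [nat] can be shared between [s] and its extensions. *)
Lemma smulP (s : seq R) v :
  v \in smul s M <-> exists m : nat -> M, v = \sum_(i < size s) s`_i *: m i.
Proof.
split=> [/(submodP (smul_subproof s M))[m ->]|[m ->]].
  exists (fun i => if insub i is Some j then m j else 0).
  by apply: eq_bigr => i _; rewrite valK.
by apply/(submodP (smul_subproof s M)); exists (fun i => m i).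
Qed.

Lemma smul_rconsP (s : seq R) (y : R) v :
  v \in smul (rcons s y) M <-> exists v', v - y *: v' \in smul s M.
Proof.
have sumE (m : nat -> M) : \sum_(i < size (rcons s y)) (rcons s y)`_i *: m i =
    \sum_(i < size s) s`_i *: m i + y *: m (size s).
  rewrite size_rcons big_ord_recr /= nth_rcons ltnn eqxx; congr (_ + _).
  by apply: eq_bigr => i _; rewrite nth_rcons ltn_ord.
split=> [/smulP[m ->]|[v' /smulP[m E]]].
  by exists (m (size s)); rewrite sumE addrK; apply/smulP; exists m.
pose m' i := if (i < size s)%N then m i else v'.
apply/smulP; exists m'; rewrite sumE /m' ltnn -[LHS](subrK (y *: v')) E; congr (_ + _).
by apply: eq_bigr => i _; rewrite ltn_ord.
Qed.

Lemma smul_nilP v : v \in smul [::] M <-> v = 0.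
Proof.
split=> [/smulP[m ->]|->]; first by rewrite big_ord0.
exact: rpred0.
Qed.

End Quotients.

(** * Comparison with the cohomology of Hom(K(x), M) *)

Section KoszulCochains.
Variables (R : comPzRingType) (n : nat) (x : n.-tuple R) (M : lmodType R).
Implicit Types (A : {set 'I_n}) (c : {set 'I_n} -> M).

Definition koszul_basis i (S : {S : {set 'I_n} | #|S| == i}) : koszul_mod R n i :=
  [ffun S' => (S' == S)%:R].

Lemma Hom_koszul_basis i (f : Defs.Hom (koszul_mod R n i) M) (v : koszul_mod R n i) :
  sub_val f v = \sum_S (v S : R) *: sub_val f (koszul_basis S).
Proof.
pose F : {linear koszul_mod R n i -> M} :=
  HB.pack (sub_val f) (GRing.isLinear.Build R _ _ *:%R (sub_val f) (Hom_linear f)).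
rewrite -[sub_val f]/(F : _ -> _) [in LHS](_ : v = \sum_S (v S : R) *: koszul_basis S).
  by rewrite linear_sum; apply: eq_bigr => S _; rewrite linearZ.
apply/ffunP => S'; rewrite sum_ffunE (bigD1 S') //= big1 => [|S SS'].
  by rewrite !ffunE eqxx addr0 /GRing.scale /= mulr1.
by rewrite !ffunE eq_sym (negPf SS') scaler0.
Qed.

Lemma Hom_koszul_eq i (f g : Defs.Hom (koszul_mod R n i) M) :
  (forall S, sub_val f (koszul_basis S) = sub_val g (koszul_basis S)) -> f = g.
Proof.
move=> fg; apply/sub_val_inj/funext => v.
by rewrite !(Hom_koszul_basis _ v); apply: eq_bigr => S _; rewrite fg.
Qed.

Definition Hom_cochain i (f : Defs.Hom (koszul_mod R n i) M) A : M :=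
  if insub A is Some B then sub_val f (koszul_basis B) else 0.

Lemma Hom_cochainE i f (S : {S : {set 'I_n} | #|S| == i}) :
  Hom_cochain f (val S) = sub_val f (koszul_basis S).
Proof. by rewrite /Hom_cochain valK. Qed.

Definition cochain_fun i c (v : koszul_mod R n i) : M :=
  \sum_S (v S : R) *: c (val S).

Lemma cochain_fun_linear i c :
  cochain_fun (i := i) c \in submod (hom_subproof (koszul_mod R n i) M).
Proof.
apply/submodP => a u v; rewrite /cochain_fun scaler_sumr -big_split.
apply: eq_bigr => S _.
by rewrite !ffunE scalerDl scalerA.
Qed.

Definition cochain_Hom i c : Defs.Hom (koszul_mod R n i) M :=
  SubMod (cochain_fun_linear i c).

Lemma cochain_HomE i c (S : {S : {set 'I_n} | #|S| == i}) :
  sub_val (cochain_Hom i c) (koszul_basis S) = c (val S).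
Proof.
rewrite /= /cochain_fun (bigD1 S) //= big1 => [|S' SS'].
  by rewrite ffunE eqxx scale1r addr0.
by rewrite ffunE (negPf SS') scale0r.
Qed.

(** The transposed differential is [cobound] on basis values: only the subsets obtained from [S] by
    removing one element contribute. With [i.-1] the case [i = 0] is included; there [S] is empty
    and both sides are 0. *)
Lemma hom_map_koszul_d i (f : Defs.Hom (koszul_mod R n i.-1) M) c
    (S : {S : {set 'I_n} | #|S| == i}) :
  (forall S', sub_val f (koszul_basis S') = c (val S')) ->
  sub_val (hom_map M (@koszul_d R n x i) f) (koszul_basis S) =
  cobound x c (val S).
Proof.
move=> fc; rewrite /= Hom_koszul_basis /cobound.
have dE S' : (koszul_d x (koszul_basis S) S' : R) =
    \sum_(k in val S | val S :\ k == val S') pos_sign R (val S) k * tnth x k.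
  rewrite ffunE (bigD1 S) //= [X in _ + X]big1 ?addr0 => [|B BS].
    by apply: eq_bigr => k _; rewrite ffunE eqxx mulr1.
  by rewrite big1 // => k _; rewrite ffunE (negPf BS) mulr0.
under eq_bigr => S' _ do rewrite dE fc scaler_suml big_mkcond.
rewrite exchange_big [RHS]big_mkcond; apply: eq_bigr => k _ /=.
case: ifP => kS; last by rewrite big1.
have Sk : #|val S :\ k| == i.-1.
  by apply/eqP; rewrite -[in RHS](eqP (valP S)) [in RHS](cardsD1 k) kS.
pose S0 : {B : {set 'I_n} | #|B| == i.-1} :=
  exist (fun B : {set _} => #|B| == _) _ Sk.
rewrite (bigD1 S0) //= eqxx big1 ?addr0 // => S' S'k.
rewrite ifF //; apply: contraNF S'k => /eqP E.
by apply/eqP/val_inj; rewrite /= E.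
Qed.

Lemma vanishes_at_koszul_coh p i :
  vanishes_at p (koszul_coh x M i) <-> local_coh0 x p (smul [::] M) i.
Proof.
rewrite vanishes_at_subquot; split=> [H c dc|H f /(submodP (ker_subproof _)) df].
  have [|u up /(submodP (im_subproof _))[g gE]] := H (cochain_Hom i c).
    apply/submodP/Hom_koszul_eq => S.
    rewrite (hom_map_koszul_d (c := c)); last exact: cochain_HomE.
    exact/smul_nilP/dc/(eqP (valP S)).
  exists u => //; exists (Hom_cochain g) => A /eqP Ai; apply/smul_nilP.
  have := congr1 (fun f => sub_val f (koszul_basis
    (exist (fun B : {set 'I_n} => #|B| == i) A Ai))) gE.
  rewrite (hom_map_koszul_d (c := Hom_cochain g)) => [->|S]; last first.
    by rewrite Hom_cochainE.
  by rewrite -[sub_val (_ *: _) _]/(u *: sub_val (cochain_Hom i c) _)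
    cochain_HomE subrr.
have [A /eqP Ai|u up [b bE]] := H (Hom_cochain f).
  apply/smul_nilP.
  rewrite -[A]/(val (exist (fun B : {set 'I_n} => #|B| == i.+1) A Ai)).
  rewrite -(@hom_map_koszul_d i.+1 f).
    by rewrite df.
  by move=> S; rewrite Hom_cochainE.
exists u => //; apply/submodP; exists (cochain_Hom i.-1 b).
apply: Hom_koszul_eq => S; rewrite (hom_map_koszul_d (c := b)); last first.
  exact: cochain_HomE.
have /smul_nilP/eqP := bE _ (eqP (valP S)).
by rewrite subr_eq0 Hom_cochainE => /eqP <-.
Qed.

End KoszulCochains.

(** * Weak regular sequences and torsion Koszul cohomology *)

Section Grades.
Variables (R : comPzRingType) (T : lmodType R -> Prop).
Hypotheses (tT : torsion_theory T) (hT : half_centered T).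
Variables (n : nat) (x : n.-tuple R) (M : lmodType R).
Implicit Types (N : submodClosed M) (v : M) (p : submodClosed R^o).

Lemma torsion_colonP N (y : R) : T (subquot (colon N y) N) <->
  forall p, prime_ideal p -> ~ T (quot_mod p) -> local_regular p N y.
Proof.
rewrite (half_centeredP tT hT).
split=> H p pp Tp.
  move=> v yv; have /vanishes_at_subquot := H p pp Tp; apply.
  exact/(submodP (colon_subproof N y)).
apply/vanishes_at_subquot => v /(submodP (colon_subproof N y)).
exact: H.
Qed.

Lemma torsion_koszul_cohP i : T (koszul_coh x M i) <->
  forall p, prime_ideal p -> ~ T (quot_mod p) -> local_coh0 x p (smul [::] M) i.
Proof.
rewrite (half_centeredP tT hT).
by split=> H p pp Tp; apply/vanishes_at_koszul_coh; apply: H.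
Qed.

(** By induction on the sum of the exponents: lowering one positive exponent [e k] by 1 puts
    [tnth x k *: v] locally in [N]. Once this holds for all [k], a multiple of [v] is a 0-cocycle
    modulo [N]. *)
Lemma local_mem_power p N v (e : 'I_n -> nat) :
  prime_ideal p -> local_coh0 x p N 0 ->
  (forall k, tnth x k ^+ e k *: v \in N) -> local_mem p N v.
Proof.
move=> pp H; have [m] := ubnP (\sum_k e k).
elim: m => // m IH in e v *; rewrite ltnS => em ev.
have xv k : true -> local_mem p N (tnth x k *: v).
  move=> _; case: (posnP (e k)) => [e0|e_gt0].
    exists 1; first by case: pp.
    by rewrite scale1r; apply: rpredZ; have := ev k; rewrite e0 scale1r.
  apply: (IH (fun j => e j - (j == k))%N) => [|j].
    apply: leq_trans em; rewrite (bigD1 k) //= [X in (_ < X)%N](bigD1 k) //=.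
    rewrite eqxx subn1 -addSn prednK // leq_add2l.
    by apply: leq_sum => j _; apply: leq_subr.
  rewrite scalerA; case: eqVneq => [->|_]; first by rewrite -exprSr subn1 prednK.
  by rewrite subn0 mulrC -scalerA; apply/rpredZ/ev.
have [u up uN] := local_mem_uniform pp xv.
(* A cochain of degree 0 is its value at the empty set, so a constant function represents it. *)
have [|w wp [b bN]] := H (fun=> u *: v).
  move=> A _; apply: rpred_sum => k _; rewrite -scalerA; apply: rpredZ.
  by rewrite scalerA mulrC -scalerA; apply: uN.
exists (w * u); first exact: prime_notinM.
have := bN finset.set0 (cards0 _).
by rewrite (cobound0 _ _ (cards0 _)) subr0 scalerA.
Qed.

(** If [p] contained every entry of [x], powers of the entries would send [v] into [N] up to factors
    outside [p]. Then [v] would be locally in [N], giving an element of its annihilator outside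
    [p]. *)
Lemma minimal_prime_ideal_gen p N v : local_coh0 x p N 0 ->
  minimal_prime_over (ann (quot_proj N v)) p -> ~ {subset ideal_gen x <= p}.
Proof.
move=> H pmin xp; have [pp annp _] := pmin.
have xkp k : (tnth x k : R^o) \in p.
  apply: xp; apply/(submodP (smul_subproof x R^o)).
  pose k' := cast_ord (esym (size_tuple x)) k.
  exists (fun j => (j == k')%:R).
  rewrite (bigD1 k') //= big1 => [|j jk]; last by rewrite (negPf jk) scaler0.
  by rewrite eqxx addr0 (tnth_nth 0) /GRing.scale /= mulr1.
suff [u up uN] : local_mem p N v.
  by move/negP: up; apply; apply: annp; rewrite ann_quot_proj.
have [e eP] : {e & forall k, local_mem p N (tnth x k ^+ e k *: v)}.
  apply: (@choice _ _ (fun k i => local_mem p N (tnth x k ^+ i *: v))) => k.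
  have [s [i [sp]]] := minimal_prime_expr pmin (xkp k).
  by rewrite ann_quot_proj -scalerA => sN; exists i, s.
have [s sp sN] := local_mem_uniform (P := predT) pp (fun k _ => eP k).
have [k|u up uN] := @local_mem_power p N (s *: v) e pp H.
  by rewrite scalerA mulrC -scalerA; apply: sN.
by exists (u * s); [apply: prime_notinM|rewrite -scalerA].
Qed.

(** Choose [y] outside the finitely many weakly associated primes of M/N with R/p not torsion. A
    weakly associated prime of (N : y)/N is one of M/N and contains [y], so its R/p is torsion, and
    half centeredness concludes. *)
Lemma exists_regular N : weakly_laskerian M ->
  (forall p, prime_ideal p -> ~ T (quot_mod p) -> local_coh0 x p N 0) ->
  exists2 y, (y : R^o) \in ideal_gen x & T (subquot (colon N y) N).
Proof.
move=> wM H.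
have /(@finite_seqP {classic submodClosed R^o})[ps psE] :
    finite_set (wAss (quot_mod N) `&` [set p | ~ T (quot_mod p)])%classic.
  exact: sub_finite_set (@subIsetl _ _ _) (wM N).
have psP p : p \in ps <-> wAss (quot_mod N) p /\ ~ T (quot_mod p).
  by have := congr1 (fun X => X p) psE; rewrite /= => ->.
have [p /psP[[w wp] Tp]|y yx yps] := @prime_avoidance R (ideal_gen x) ps.
  have [pp _ _] := wp; split=> //.
  rewrite -(quot_reprK w) in wp.
  exact: minimal_prime_ideal_gen (H p pp Tp) wp.
exists y => //; apply: hT => p /wAss_subquot[v [vy vp]].
apply: contrapT => Tp; have /negP[] : (y : R^o) \notin p.
  by apply/yps/psP; split=> //; exists (quot_proj N v).
have [_ annp _] := vp; apply: annp; rewrite ann_quot_proj.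
exact/(submodP (colon_subproof N y)).
Qed.

Lemma weak_regular_coh (s : seq R) :
  {in s, forall y, (y : R^o) \in ideal_gen x} -> weak_regular T M s ->
  forall i, (i < size s)%N -> T (koszul_coh x M i).
Proof.
move=> sx sreg i i_lt; apply/torsion_koszul_cohP => p pp Tp.
(* Induction on the number [d] of elements still to be divided out: each element put back raises the
   range of vanishing by one degree. *)
suff H d : (d <= size s)%N -> forall i, (i < d)%N ->
    local_coh0 x p (smul (take (size s - d) s) M) i.
  by have := H _ (leqnn _) i i_lt; rewrite subnn take0.
elim: d => // d IH d_lt j j_lt; set r := (size s - d.+1)%N.
have r_lt : (r < size s)%N by rewrite /r ltn_subrL (leq_ltn_trans _ d_lt).
have rS : (size s - d)%N = r.+1 by rewrite /r subnSK.
have xr : (s`_r : R^o) \in ideal_gen x by apply/sx/mem_nth.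
have reg : local_regular p (smul (take r s) M) s`_r.
  by have /torsion_colonP := sreg r r_lt; apply.
case: j j_lt => [_|j j_lt]; first exact: local_coh0_0 reg xr.
apply: (local_coh0_up pp reg (smul_rconsP _ _) xr).
by rewrite -take_nth // -rS; apply: IH => //; apply: ltnW.
Qed.

Lemma coh_weak_regular r : weakly_laskerian M ->
  (forall i, (i < r)%N -> T (koszul_coh x M i)) ->
  exists s : seq R, [/\ size s = r,
    {in s, forall y, (y : R^o) \in ideal_gen x} & weak_regular T M s].
Proof.
move=> wM TH.
(* The sequence is built one element at a time, and each costs one degree of local vanishing; while
   [j < r], degree 0 is still available to find the next element. *)
suff H j : (j <= r)%N -> exists s : seq R, [/\ size s = j,
    {in s, forall y, (y : R^o) \in ideal_gen x}, weak_regular T M s &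
    forall p, prime_ideal p -> ~ T (quot_mod p) ->
      forall i, (i < r - j)%N -> local_coh0 x p (smul s M) i].
  by have [s [? ? ? _]] := H r (leqnn r); exists s.
elim: j => [_|j IH j_lt].
  exists [::]; split=> // p pp Tp i; rewrite subn0 => /TH/torsion_koszul_cohP.
  exact.
have [s [sj sx sreg scoh]] := IH (ltnW j_lt).
have [|y yx yreg] := @exists_regular (smul s M) wM.
  by move=> p pp Tp; apply: scoh => //; rewrite subn_gt0.
exists (rcons s y); split.
- by rewrite size_rcons sj.
- by move=> z; rewrite mem_rcons inE => /predU1P[->|/sx].
- move=> i; rewrite size_rcons ltnS leq_eqVlt => /predU1P[->|i_lt].
    by rewrite nth_rcons ltnn eqxx -cats1 take_size_cat.
  by rewrite nth_rcons i_lt -cats1 takel_cat ?(ltnW i_lt) //; apply: sreg.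
- move=> p pp Tp i; rewrite subnS -ltnS => i_lt.
  have ij : (i.+1 < r - j)%N by rewrite prednK ?subn_gt0 in i_lt.
  apply: (local_coh0_down pp _ (smul_rconsP _ _)).
  + by move/torsion_colonP: yreg; apply.
  + exact/scoh/ltnW.
  + exact: scoh.
Qed.

End Grades.

(** * Extrema and the equality of the two grades *)

Lemma supremum_unique d (X : porderType d) (x0 t : X) (A : set X) :
  (A !=set0)%classic -> supremums A t -> supremum x0 A = t.
Proof.
move=> /set0P A0 At; rewrite /supremum (negPf A0).
case: xgetP => [u E Au|H]; last by case: (H t).
by apply: is_subset1_supremums Au At.
Qed.

Lemma infimum_unique d (X : porderType d) (x0 t : X) (A : set X) :
  (A !=set0)%classic -> infimums A t -> infimum x0 A = t.
Proof.
move=> /set0P A0 At; rewrite /infimum (negPf A0).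
case: xgetP => [u E Au|H]; last by case: (H t).
by apply: is_subset1_infimums Au At.
Qed.

Theorem theorem1p2 (R : comPzRingType) (T : lmodType R -> Prop)
    (a : submodClosed R^o) (n : nat) (x : n.-tuple R) (M : lmodType R) :
  torsion_theory T -> half_centered T ->
  a =i ideal_gen x ->
  weakly_laskerian M ->
  c_grade T a M = K_grade T x M.
Proof.
move=> tT hT ax wM; rewrite /c_grade /K_grade.
set C := (X in supremum _ X); set K := (X in infimum _ X).
have C_coh (s : seq R) i : {in s, forall y, (y : R^o) \in a} ->
    weak_regular T M s -> (i < size s)%N -> T (koszul_coh x M i).
  by move=> sa sreg; apply: weak_regular_coh => // y /sa; rewrite ax.
have coh_C r : (forall i, (i < r)%N -> T (koszul_coh x M i)) -> C r%:Z%:E.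
  move=> /(coh_weak_regular tT hT wM)[s [sr sx sreg]].
  by exists s; [split=> // y ys; rewrite ax; apply: sx|rewrite sr].
have C0 : (C !=set0)%classic by exists 0%:E; apply: coh_C.
have [[i Ti]|nK] := pselect (exists i, ~ T (koszul_coh x M i)); last first.
  have cohT i : T (koszul_coh x M i) by apply: contrapT => ?; apply: nK; exists i.
  rewrite [K](_ : _ = set0); last first.
    by apply/seteqP; split=> // z [i nT]; case: (nT (cohT i)).
  rewrite /infimum eqxx; apply: supremum_unique => //.
  split=> [z _|z zub]; first exact: leey.
  (* All lengths occur in [C]: the length 0 excludes the bound -oo, and the length |z| + 1 excludes
     a finite bound [z]. *)
  case: z zub => [z|//|] zub; last by have := zub _ (coh_C 0%N (fun i _ => cohT i)).
  have := zub _ (coh_C (absz z).+1 (fun i _ => cohT i)).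
  rewrite lee_fin => h; have := Order.POrderTheory.le_trans h (Num.Theory.ler_norm z).
  by rewrite -abszE lez_nat ltnn.
(* Both grades equal the least degree [m] of non-torsion cohomology: a longer weak regular sequence
   would make degree [m] torsion, and torsion below [m] yields a sequence of length [m]. *)
have [m /asboolP mT m_min] := @ex_minnP (fun i => `[< ~ T (koszul_coh x M i) >])
  (ex_intro _ i (asboolT Ti)).
have m_coh j : (j < m)%N -> T (koszul_coh x M j).
  by move=> jm; apply: contrapT => /asboolP/m_min; rewrite leqNgt jm.
transitivity (m%:Z%:E : \bar int).
  apply: supremum_unique => //; split=> [_ [s [sa sreg] <-]|z zub].
    rewrite lee_fin lez_nat leqNgt; apply/negP => sm; exact: mT (C_coh s m sa sreg sm).
  exact/zub/coh_C.
apply/esym/infimum_unique; first by exists m%:Z%:E; exists m.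
split=> [_ [j /asboolP/m_min jm <-]|z zlb]; first by rewrite lee_fin lez_nat.
by apply: zlb; exists m.
Qed.
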